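(* Let $\mathbb{K}$ be an algebraically closed field of characteristic zero and let $(A,[\cdot,\cdot])$ be a finite-dimensional left-Alia algebra over $\mathbb{K}$. Suppose that there is a left-Alia algebra structure $(A^*,\{\cdot,\cdot\})$ on the dual space $A^*$, and that $\delta:A\to A\otimes A$ is the dual of $\{\cdot,\cdot\}$, i.e. $\langle\{a^*,b^*\},x\rangle=\langle a^*\otimes b^*,\delta(x)\rangle$ for all $x\in A$, $a^*,b^*\in A^*$. Then the following conditions are equivalent: (a) There is a Manin triple of left-Alia algebras $\big((A\oplus A^*,[\cdot,\cdot]_d,\mathcal{B}_d),A,A^*\big)$, where $$[(x,u),(y,v)]_d=([x,y],\,l(x)v+r(y)u),\quad\forall x,y\in A,\ u,v\in A^*,$$ with $(l,r,A^* )$ a representation of the left-Alia algebra $(A,[\cdot,\cdot])$ on $A^*$, and $$\mathcal{B}_d((x,u),(y,v))=\langle x,v\rangle+\langle y,u\rangle,\quad\forall x,y\in A,\ u,v\in A^*.$$ (b) $(A,[\cdot,\cdot],\delta)$ is a left-Alia bialgebra.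
   Context: A left-Alia algebra is a vector space $A$ with a bilinear map $[\cdot,\cdot]:A\times A\to A$ such that $[[x,y],z]+[[y,z],x]+[[z,x],y]=[[y,x],z]+[[z,y],x]+[[x,z],y]$ for all $x,y,z\in A$. A representation of a left-Alia algebra $(A,[\cdot,\cdot])$ is a triple $(l,r,V)$, where $V$ is a vector space and $l,r:A\to\mathrm{End}(V)$ are linear maps such that $l([x,y])v-l([y,x])v=r(x)r(y)v-r(y)r(x)v+r(y)l(x)v-r(x)l(y)v$ for all $x,y\in A$, $v\in V$. A quadratic left-Alia algebra is a left-Alia algebra with a nondegenerate symmetric bilinear form $\mathcal{B}$ satisfying $\mathcal{B}([x,y],z)=\mathcal{B}(x,[z,y]-[y,z])$ for all $x,y,z$. A Manin triple of left-Alia algebras $\big((A\oplus A^*,[\cdot,\cdot]_d,\mathcal{B}_d),A,A^*\big)$, for left-Alia algebras $(A,[\cdot,\cdot])$ and $(A^*,\{\cdot,\cdot\})$, consists of a left-Alia algebra structure $[\cdot,\cdot]_d$ on $A\oplus A^*$ which contains $(A,[\cdot,\cdot])$ and $(A^*,\{\cdot,\cdot\})$ as left-Alia subalgebras and is such that $(A\oplus A^*,[\cdot,\cdot]_d,\mathcal{B}_d)$ is a quadratic left-Alia algebra, where $\mathcal{B}_d$ is the natural form written in the claim. A left-Alia coalgebra is a pair $(A,\delta)$ with $\delta:A\to A\otimes A$ linear and $(\mathrm{id}^{\otimes3}+\xi+\xi^2)(\tau\otimes\mathrm{id}-\mathrm{id}^{\otimes3})(\delta\otimes\mathrm{id})\delta=0$,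 where $\tau(x\otimes y)=y\otimes x$ and $\xi(x\otimes y\otimes z)=y\otimes z\otimes x$. A left-Alia bialgebra is a triple $(A,[\cdot,\cdot],\delta)$ such that $(A,[\cdot,\cdot])$ is a left-Alia algebra, $(A,\delta)$ is a left-Alia coalgebra, and for all $x,y\in A$ $$(\tau-\mathrm{id}^{\otimes2})\big(\delta([x,y]-[y,x])+(\mathcal{R}(x)\otimes\mathrm{id})\delta(y)-(\mathcal{R}(y)\otimes\mathrm{id})\delta(x)\big)=0,$$ where $\mathcal{R}(y)x=[x,y]$.
   Formalization: The product in (a) gains the missing terms: [(x,u),(y,v)]_d = ([x,y]+l'(u)y+r'(v)x, l(x)v+r(y)u+{u,v}), with (l',r',A) a representation of (A^*,{,}); as printed, containing (A^*,{,}) as a subalgebra forces {,}=0, which (b) does not imply. *)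

(* Defs.v *)
From HB Require Import structures.
From mathcomp Require Import all_boot all_order all_algebra.

Set Implicit Arguments.
Unset Strict Implicit.
Unset Printing Implicit Defensive.

Import GRing.Theory.
Local Open Scope ring_scope.

Definition dual {K : fieldType} (V : vectType K) : vectType K := 'Hom(V, K^o).

(* ------------------------------------------------------------------------ *)
(* The tensor product of two finite-dimensional spaces, carried by the      *)
(* coordinate matrices with respect to the bases vbasis {:U} and            *)
(* vbasis {:V}.  [tensor_lift_pure] and [tensor_ext] are its universal      *)
(* property, so nothing below depends on the choice of the carrier.         *)
(* ------------------------------------------------------------------------ *)

Section Tensor.
Context {K : fieldType}.
Implicit Types U V W : vectType K.

Definition tensor U V : vectType K := 'M[K]_(\dim {:U}, \dim {:V}).

Definition pure {U V} (x : U) (y : V) : tensor U V :=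
  \matrix_(i, j) (coord (vbasis {:U}) i x * coord (vbasis {:V}) j y).

(* For bilinear [f], the linear map sending [pure x y] to [f x y]. *)
Definition tensor_lift {U V W} (f : U -> V -> W) (t : tensor U V) : W :=
  \sum_i \sum_j t i j *: f (vbasis {:U})`_i (vbasis {:V})`_j.

Lemma tensor_lift_is_linear U V W (f : U -> V -> W) : linear (tensor_lift f).
Proof.
move=> a s t; rewrite /tensor_lift scaler_sumr -big_split; apply: eq_bigr => i _.
rewrite scaler_sumr -big_split; apply: eq_bigr => j _.
by rewrite !mxE scalerDl scalerA.
Qed.

HB.instance Definition _ U V W (f : U -> V -> W) :=
  GRing.isLinear.Build K (tensor U V) W *:%R (tensor_lift f)
    (tensor_lift_is_linear f).

Lemma pure_is_bilinear U V : bilinear_for *:%R *:%R (@pure U V).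
Proof.
split=> [y a x x' | x a y y']; apply/matrixP=> i j; rewrite !mxE !linearP /=.
  by rewrite mulrDl mulrA.
by rewrite mulrDr mulrCA.
Qed.

HB.instance Definition _ U V :=
  bilinear_isBilinear.Build K U V (tensor U V) *:%R *:%R (@pure U V)
    (pure_is_bilinear U V).

Lemma tensor_lift_pure U V W (f : U -> V -> W) (x : U) (y : V) :
  bilinear_for *:%R *:%R f -> tensor_lift f (pure x y) = f x y.
Proof.
case=> fl fr.
pose fL v := HB.pack_for {linear U -> W} (f ^~ v)
  (GRing.isLinear.Build K U W *:%R (f ^~ v) (fl v)).
pose fR u := HB.pack_for {linear V -> W} (f u)
  (GRing.isLinear.Build K V W *:%R (f u) (fr u)).
rewrite /tensor_lift.
transitivity (\sum_i coord (vbasis {:U}) i x *: f (vbasis {:U})`_i y).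
  apply: eq_bigr => i _.
  transitivity (coord (vbasis {:U}) i x *: fR (vbasis {:U})`_i
      (\sum_j coord (vbasis {:V}) j y *: (vbasis {:V})`_j)).
    rewrite linear_sum scaler_sumr; apply: eq_bigr => j _.
    by rewrite linearZ mxE scalerA.
  by rewrite -(coord_vbasis (memvf y)).
transitivity (fL y (\sum_i coord (vbasis {:U}) i x *: (vbasis {:U})`_i)).
  by rewrite linear_sum; apply: eq_bigr => i _; rewrite linearZ.
by rewrite -(coord_vbasis (memvf x)).
Qed.

Lemma tensor_ext U V W (f g : {linear tensor U V -> W}) :
  (forall x y, f (pure x y) = g (pure x y)) -> f =1 g.
Proof.
move=> fg t.
have -> : t = \sum_i \sum_j t i j *: pure (vbasis {:U})`_i (vbasis {:V})`_j.
  apply/matrixP=> k l; rewrite summxE (bigD1 k) //= summxE (bigD1 l) //= big1.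
    rewrite big1 => [|i ik].
      by rewrite !mxE !coord_free ?(basis_free (vbasisP _)) ?eqxx //= !mulr1 !addr0.
    rewrite summxE big1 // => j _; rewrite !mxE.
    rewrite (coord_free _ _ (basis_free (vbasisP {:U}))).
    by rewrite (negPf ik) mul0r mulr0.
  move=> j jl; rewrite !mxE (coord_free _ _ (basis_free (vbasisP {:V}))).
  by rewrite (negPf jl) !mulr0.
rewrite !linear_sum; apply: eq_bigr => i _; rewrite !linear_sum.
by apply: eq_bigr => j _; rewrite !linearZ /= fg.
Qed.

(* <a (x) b, t>, with <a (x) b, x (x) y> = <a, x> <b, y>. *)
Definition tensor_pairing {U V} (a : dual U) (b : dual V) (t : tensor U V) : K :=
  tensor_lift (fun x y => a x * b y : K^o) t.

(* f (x) g : x (x) y |-> f x (x) g y. *)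
Definition tensor_map {U V U' V' : vectType K} (f : U -> U') (g : V -> V')
    (t : tensor U V) : tensor U' V' :=
  tensor_lift (fun x y => pure (f x) (g y)) t.

(* tau : x (x) y |-> y (x) x. *)
Definition tau {U V} (t : tensor U V) : tensor V U :=
  tensor_lift (fun x y => pure y x) t.

(* xi : x (x) y (x) z |-> y (x) z (x) x. *)
Definition xi {V} (t : tensor (tensor V V) V) : tensor (tensor V V) V :=
  tensor_lift (fun s z => tensor_lift (fun x y => pure (pure y z) x) s) t.

HB.instance Definition _ U V (a : dual U) (b : dual V) :=
  GRing.Linear.copy (tensor_pairing a b : tensor U V -> K^o) (tensor_lift _).
HB.instance Definition _ U V U' V' (f : U -> U') (g : V -> V') :=
  GRing.Linear.copy (tensor_map f g) (tensor_lift _).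
HB.instance Definition _ U V := GRing.Linear.copy (@tau U V) (tensor_lift _).
HB.instance Definition _ V := GRing.Linear.copy (@xi V) (tensor_lift _).

Lemma tensor_pairingE U V (a : dual U) (b : dual V) x y :
  tensor_pairing a b (pure x y) = a x * b y.
Proof.
rewrite /tensor_pairing tensor_lift_pure //; split=> [u c v w | u c v w] /=.
  by rewrite linearP /= mulrDl -mulrA.
by rewrite linearP /= mulrDr mulrCA.
Qed.

Lemma tensor_mapE U V U' V' (f : {linear U -> U'}) (g : {linear V -> V'}) x y :
  tensor_map f g (pure x y) = pure (f x) (g y).
Proof.
rewrite /tensor_map tensor_lift_pure //; split=> [u c v w | u c v w] /=.
  by rewrite linearP linearPl.
by rewrite linearP linearPr.
Qed.

Lemma tauE U V (x : U) (y : V) : tau (pure x y) = pure y x.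
Proof.
rewrite /tau tensor_lift_pure //; split=> [u c v w | u c v w] /=.
  by rewrite linearPr.
by rewrite linearPl.
Qed.

Lemma xiE V (x y z : V) : xi (pure (pure x y) z) = pure (pure y z) x.
Proof.
have lift3 w : bilinear_for *:%R *:%R (fun x y : V => pure (pure y w) x).
  split=> [u c v v' | u c v v'] /=; first by rewrite linearPr.
  by rewrite !linearPl.
rewrite /xi tensor_lift_pure; first by rewrite tensor_lift_pure.
split=> [u c v w | u c v w]; first exact: linearP.
rewrite /= /tensor_lift scaler_sumr -big_split; apply: eq_bigr => i _.
rewrite scaler_sumr -big_split; apply: eq_bigr => j _ /=.
by rewrite linearPr linearPl scalerDr !scalerA mulrC.
Qed.

End Tensor.

Section LeftAlia.
Context {K : fieldType}.
Implicit Types A V : vectType K.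

Definition left_alia A (br : {bilinear A -> A -> A}) : Prop :=
  forall x y z,
    br (br x y) z + br (br y z) x + br (br z x) y =
    br (br y x) z + br (br z y) x + br (br x z) y.

Definition representation A (br : {bilinear A -> A -> A}) V
    (l r : {linear A -> 'End(V)}) : Prop :=
  forall x y v,
    l (br x y) v - l (br y x) v =
    r x (r y v) - r y (r x v) + r y (l x v) - r x (l y v).

Definition quadratic_left_alia A (br : {bilinear A -> A -> A})
    (B : {symmetric A}) : Prop :=
  [/\ left_alia br, nondegenerate B &
      forall x y z, B (br x y) z = B x (br z y - br y z)].

Definition natural_form A (z w : A * dual A) : K := w.2 z.1 + z.2 w.1.

Lemma natural_form_is_bilinear A : bilinear_for *%R *%R (@natural_form A).
Proof.
split=> [w a z z' | z a w w']; rewrite /natural_form /= !linearP !lfunE /=.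
  by rewrite lfunE mulrDr addrACA.
by rewrite lfunE mulrDr addrACA.
Qed.

HB.instance Definition _ A :=
  bilinear_isBilinear.Build K _ _ K *%R *%R (@natural_form A)
    (natural_form_is_bilinear A).

Lemma natural_form_sym A (z w : A * dual A) :
  natural_form z w = (-1) ^+ false * idfun (natural_form w z).
Proof. by rewrite mul1r /= /natural_form addrC. Qed.

HB.instance Definition _ A :=
  isHermitianSesquilinear.Build K _ false idfun (@natural_form A)
    (@natural_form_sym A).

(* A (+) A^* is A * dual A, with A and A^* embedded as (x, 0) and (0, u). *)
Definition manin_triple A (br : {bilinear A -> A -> A})
    (dbr : {bilinear dual A -> dual A -> dual A})
    (brd : {bilinear (A * dual A) -> (A * dual A) -> (A * dual A)}) : Prop :=
  [/\ forall x y, brd (x, 0) (y, 0) = (br x y, 0),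
      forall u v, brd (0, u) (0, v) = (0, dbr u v) &
      quadratic_left_alia brd (@natural_form A)].

Definition left_alia_coalgebra A (delta : {linear A -> tensor A A}) : Prop :=
  forall x,
    let s := tensor_map delta idfun (delta x) in
    let t := tensor_map tau idfun s - s in
    t + xi t + xi (xi t) = 0.

(* Right multiplications: rmul br y x = [x, y]. *)
Definition rmul A (br : {bilinear A -> A -> A}) (y x : A) : A := br x y.

Definition left_alia_bialgebra A (br : {bilinear A -> A -> A})
    (delta : {linear A -> tensor A A}) : Prop :=
  [/\ left_alia br, left_alia_coalgebra delta &
      forall x y,
        let t := delta (br x y - br y x)
                 + tensor_map (rmul br x) idfun (delta y)
                 - tensor_map (rmul br y) idfun (delta x) in
        tau t - t = 0].

End LeftAlia.

(* Main.v *)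
Require Import Defs.
From HB Require Import structures.
From mathcomp Require Import all_boot all_order all_algebra ring.

Set Implicit Arguments.
Unset Strict Implicit.
Unset Printing Implicit Defensive.

Import GRing.Theory.
Local Open Scope ring_scope.

(** An invariant bilinear form [B] turns the Jacobi-type expression of a bracket
    with commutator [a] into
      [- B (J p q r) s
         = B (a p q) (a r s) + B (a q r) (a p s) + B (a r p) (a q s)],
    which is alternating in all four arguments.  On [A (+) A^*] invariance under
    the natural form leaves a single choice for the mixed brackets, and the
    four-form only has to be tested on arguments taken from [A] or [A^*]: it
    vanishes for four arguments of one kind, three from [A] and one from [A^*]
    give the left-Alia identity of [A], one and three that of [A^*], and two and
    two give the compatibility condition of a left-Alia bialgebra.  The
    representation property of the coadjoint maps and the coalgebra identity are
    the left-Alia identities of [A] and [A^*] paired with dual elements. *)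

(** * Detecting tensors by pairing with dual vectors *)

Section TensorDuality.
Context {K : fieldType}.
Implicit Types U V W : vectType K.

Lemma dual_eq0 V (x : V) : (forall u : dual V, u x = 0) -> x = 0.
Proof.
move=> x0; rewrite (coord_vbasis (memvf x)) big1 // => i _.
have := x0 (linfun (coord (vbasis {:V}) i : V -> K^o)).
by rewrite lfunE => ->; rewrite scale0r.
Qed.

(** Functionals separate points, so an identity of vectors becomes one of scalars, which [ring] can
    decide. *)
Lemma dual_inj V (x y : V) : (forall u : dual V, u x = u y) -> x = y.
Proof.
move=> xy; apply/eqP; rewrite -subr_eq0; apply/eqP/dual_eq0 => u.
by rewrite linearB /= xy subrr.
Qed.

(** This is [id ⊗ c]; it lets nested tensors be handled one factor at a time. *)
Definition contract {U V} (c : dual V) (t : tensor U V) : U :=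
  tensor_lift (fun x y => c y *: x) t.

HB.instance Definition _ U V (c : dual V) :=
  GRing.Linear.copy (contract c : tensor U V -> U) (tensor_lift _).

Lemma contractE U V (c : dual V) (x : U) (y : V) :
  contract c (pure x y) = c y *: x.
Proof.
rewrite /contract tensor_lift_pure //; split=> [u k v w | u k v w] /=.
  by rewrite scalerDr scalerA mulrC -scalerA.
by rewrite linearP scalerDl -scalerA.
Qed.

Lemma dual_contract U V (a : dual U) (c : dual V) (t : tensor U V) :
  a (contract c t) = tensor_pairing a c t.
Proof.
apply: (tensor_ext (f := (a \o contract c)%FUN)
  (g := (tensor_pairing a c : _ -> K^o)) _ t) => x y /=.
by rewrite contractE tensor_pairingE linearZ /= mulrC.
Qed.

Lemma contract_is_linear_dual U V (t : tensor U V) : linear (contract ^~ t).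
Proof.
move=> k c d; rewrite /contract /tensor_lift scaler_sumr -big_split.
apply: eq_bigr => i _; rewrite scaler_sumr -big_split; apply: eq_bigr => j _.
rewrite add_lfunE scale_lfunE scalerDl scalerDr.
by rewrite !scalerA mulrCA mulrA.
Qed.

(** Each matrix entry is the pairing with two coordinate functionals. *)
Lemma tensor_eq0 U V (t : tensor U V) :
  (forall a b, tensor_pairing a b t = 0) -> t = 0.
Proof.
move=> t0; apply/matrixP=> i j; rewrite [RHS]mxE.
pose coordf W k : dual W := linfun (coord (vbasis {:W}) k : W -> K^o).
have e_lin : linear (fun s : tensor U V => s i j : K^o).
  by move=> k s s'; rewrite !mxE.
pose e := HB.pack_for {linear tensor U V -> K^o}
  (fun s : tensor U V => s i j : K^o)
  (GRing.isLinear.Build K (tensor U V) K^o *:%R _ e_lin).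
transitivity (tensor_pairing (coordf U i) (coordf V j) t); last exact: t0.
apply: (tensor_ext (f := e)
  (g := (tensor_pairing (coordf U i) (coordf V j) : _ -> K^o)) _ t) => x y.
by rewrite /= tensor_pairingE mxE !lfunE.
Qed.

Definition pairing3 {U V W} (a : dual U) (b : dual V) (c : dual W)
    (t : tensor (tensor U V) W) : K := tensor_pairing a b (contract c t).

HB.instance Definition _ U V W (a : dual U) (b : dual V) (c : dual W) :=
  GRing.Linear.copy
    (pairing3 a b c : tensor (tensor U V) W -> K^o)
    ((tensor_pairing a b : _ -> K^o) \o contract c)%FUN.

Lemma pairing3_eq0 U V W (t : tensor (tensor U V) W) :
  (forall a b c, pairing3 a b c t = 0) -> t = 0.
Proof.
move=> t0; apply: tensor_eq0 => f c; rewrite -dual_contract.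
(* [f] is an arbitrary functional on [tensor U V]; contracting with [c] first gives a tensor that is
   already zero, whatever [f] is. *)
by rewrite (tensor_eq0 (t := contract c t)) ?linear0 // => a b; exact: t0.
Qed.

Lemma pairing3E U V W (a : dual U) (b : dual V) (c : dual W) s z :
  pairing3 a b c (pure s z) = c z * tensor_pairing a b s.
Proof. by rewrite /pairing3 contractE linearZ. Qed.

(** [tensor_ext] is applied twice, the second time with the last factor frozen. *)
Lemma tensor3_ext U V W W' (f g : {linear tensor (tensor U V) W -> W'}) :
  (forall x y z, f (pure (pure x y) z) = g (pure (pure x y) z)) -> f =1 g.
Proof.
move=> fg; apply: tensor_ext => s z.
have lin (h : {linear tensor (tensor U V) W -> W'}) :
    linear (fun s : tensor U V => h (pure s z)).
  by move=> k s1 s2; rewrite linearPl linearP.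
pose L (h : {linear tensor (tensor U V) W -> W'}) :=
  HB.pack_for {linear tensor U V -> W'} (fun s : tensor U V => h (pure s z))
  (GRing.isLinear.Build K (tensor U V) W' *:%R _ (lin h)).
by apply: (tensor_ext (f := L f) (g := L g)) => x y; apply: fg.
Qed.

Lemma pairing3_xi V (a b c : dual V) t :
  pairing3 a b c (xi t) = pairing3 c a b t.
Proof.
apply: (tensor3_ext (f := ((pairing3 a b c : _ -> K^o) \o xi)%FUN)
  (g := (pairing3 c a b : _ -> K^o)) _ t) => x y z /=.
by rewrite xiE !pairing3E !tensor_pairingE /=; ring.
Qed.

Lemma pairing3_tau U V W (a : dual U) (b : dual V) (c : dual W) t :
  pairing3 a b c (tensor_map tau idfun t) = pairing3 b a c t.
Proof.
apply: (tensor3_ext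
  (f := ((pairing3 a b c : _ -> K^o) \o tensor_map tau idfun)%FUN)
  (g := (pairing3 b a c : _ -> K^o)) _ t) => x y z /=.
by rewrite tensor_mapE /= tauE !pairing3E !tensor_pairingE [X in _ * X]mulrC.
Qed.

(** [d] is the transpose of [f] at [a ⊗ b]. For [f = delta] it is [dbr a b], so iterated coproducts
    turn into iterated brackets. *)
Lemma pairing3_tensor_mapl U V W V' (f : {linear V -> tensor U W})
    (a : dual U) (b : dual W) (c : dual V') (d : dual V) t :
  (forall x, d x = tensor_pairing a b (f x)) ->
  pairing3 a b c (tensor_map f idfun t) = tensor_pairing d c t.
Proof.
move=> dE; apply: (tensor_ext
  (f := ((pairing3 a b c : _ -> K^o) \o tensor_map f idfun)%FUN)
  (g := (tensor_pairing d c : _ -> K^o)) _ t) => x y /=.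
by rewrite tensor_mapE pairing3E tensor_pairingE dE mulrC.
Qed.

Lemma tensor_pairing_tau U V (a : dual V) (b : dual U) (t : tensor U V) :
  tensor_pairing a b (tau t) = tensor_pairing b a t.
Proof.
apply: (tensor_ext (f := ((tensor_pairing a b : _ -> K^o) \o tau)%FUN)
  (g := (tensor_pairing b a : _ -> K^o)) _ t) => x y /=.
by rewrite tauE !tensor_pairingE mulrC.
Qed.

Lemma tensor_pairing_mapl U V W (f : {linear U -> W}) (a : dual W) (b : dual V)
    (t : tensor U V) :
  tensor_pairing a b (tensor_map f idfun t) =
  tensor_pairing (a \o linfun f)%VF b t.
Proof.
apply: (tensor_ext
  (f := ((tensor_pairing a b : _ -> K^o) \o tensor_map f idfun)%FUN)
  (g := (tensor_pairing (a \o linfun f)%VF b : _ -> K^o)) _ t) => x y /=.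
by rewrite tensor_mapE !tensor_pairingE comp_lfunE lfunE.
Qed.

End TensorDuality.

(** * Coalgebra and compatibility conditions in dual form *)

Section Bialgebra.
Context {K : fieldType} {A : vectType K}.
Implicit Types (br : {bilinear A -> A -> A}).

Lemma rmul_is_linear br x : linear (rmul br x).
Proof. by move=> k y z; rewrite /rmul linearPl. Qed.

HB.instance Definition _ br x :=
  GRing.isLinear.Build K A A *:%R (rmul br x) (rmul_is_linear br x).

Definition rmul_dual br x (u : dual A) : dual A := (u \o linfun (rmul br x))%VF.

Lemma rmul_dualE br x u y : rmul_dual br x u y = u (br y x).
Proof. by rewrite comp_lfunE lfunE. Qed.

(** The compatibility expression of a bialgebra paired with [v ⊗ u], the coproduct being replaced by
    [dbr]. *)
Definition bialgebra_defect br (dbr : {bilinear dual A -> dual A -> dual A})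
    (x y : A) (u v : dual A) : K :=
  (dbr u v - dbr v u) (br x y - br y x)
  + dbr (rmul_dual br x u) v y - dbr (rmul_dual br y u) v x
  - dbr (rmul_dual br x v) u y + dbr (rmul_dual br y v) u x.

Variables (br : {bilinear A -> A -> A}).
Variables (dbr : {bilinear dual A -> dual A -> dual A}).
Variables (delta : {linear A -> tensor A A}).
Hypothesis delta_dual : forall (a b : dual A) (x : A),
  dbr a b x = tensor_pairing a b (delta x).

Lemma left_alia_coalgebra_dual : left_alia dbr -> left_alia_coalgebra delta.
Proof.
move=> dbr_alia x s t; apply: pairing3_eq0 => a b c.
have sE a' b' c' : pairing3 a' b' c' s = dbr (dbr a' b') c' x.
  rewrite delta_dual; apply: pairing3_tensor_mapl => y; exact: delta_dual.
have tE a' b' c' :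
    pairing3 a' b' c' t = dbr (dbr b' a') c' x - dbr (dbr a' b') c' x.
  by rewrite linearB /= pairing3_tau !sE.
clearbody t; rewrite 2!linearD /= !pairing3_xi !tE.
have := congr1 (fun f : dual A => f x) (dbr_alia a b c).
rewrite !add_lfunE => /eqP; rewrite -subr_eq0 => /eqP jac.
(* The cyclic sum is the right side minus the left side of the left-Alia identity for [a], [b],
   [c]. *)
by rewrite -[RHS]oppr0 -[in RHS]jac; ring.
Qed.

Lemma bialgebra_defectP :
  (forall x y, let t := delta (br x y - br y x)
                 + tensor_map (rmul br x) idfun (delta y)
                 - tensor_map (rmul br y) idfun (delta x) in
     tau t - t = 0)
  <-> forall x y u v, bialgebra_defect br dbr x y u v = 0.
Proof.
have pairE x y u v : let t := delta (br x y - br y x)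
                 + tensor_map (rmul br x) idfun (delta y)
                 - tensor_map (rmul br y) idfun (delta x) in
    tensor_pairing v u (tau t - t) = bialgebra_defect br dbr x y u v.
  move=> t; rewrite linearB /= tensor_pairing_tau.
  have tE a b : tensor_pairing a b t = dbr a b (br x y - br y x)
      + dbr (rmul_dual br x a) b y - dbr (rmul_dual br y a) b x.
    by rewrite linearB linearD /= !tensor_pairing_mapl -!delta_dual.
  by rewrite !tE /bialgebra_defect add_lfunE opp_lfunE /=; ring.
split=> [tau0 x y u v | defect0 x y t]; first by rewrite -pairE tau0 linear0.
by apply: tensor_eq0 => v u; rewrite pairE.
Qed.

End Bialgebra.

(** * The left-Alia identity by commutators; nondegeneracy of the natural form *)

Section Quadratic.
Context {K : fieldType}.
Implicit Types (V A : vectType K).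

Lemma dualD V (f : dual V) x y : f (x + y) = (f x : K) + f y.
Proof. exact: linearD. Qed.

Lemma dualZ V (f : dual V) k x : f (k *: x) = k * (f x : K).
Proof. exact: linearZ. Qed.

Lemma dualN V (f : dual V) x : f (- x) = - (f x : K).
Proof. exact: linearN. Qed.

Definition alt V (br : V -> V -> V) x y := br x y - br y x.

(** Moving all terms of the left-Alia identity to one side pairs the inner brackets into
    commutators. *)
Definition jacobiator V (br : V -> V -> V) x y z :=
  br (alt br x y) z + br (alt br y z) x + br (alt br z x) y.

Lemma left_aliaP V (br : {bilinear V -> V -> V}) :
  left_alia br <-> forall x y z, jacobiator br x y z = 0.
Proof.
have E x y z : jacobiator br x y z =
    (br (br x y) z + br (br y z) x + br (br z x) y)
    - (br (br y x) z + br (br z y) x + br (br x z) y).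
  rewrite /jacobiator /alt !linearBl /=.
  by apply: dual_inj => f; rewrite !(dualD, dualN); ring.
split=> [alia x y z | jac0 x y z]; first by rewrite E alia subrr.
by apply/eqP; rewrite -subr_eq0 -E jac0.
Qed.

Lemma natural_form_eq0 A (z : A * dual A) :
  (forall w, natural_form z w = 0) -> z = 0.
Proof.
case: z => x u z0; congr (_, _).
  apply: dual_eq0 => v; have := z0 (0, v).
  by rewrite /natural_form /= linear0 addr0.
apply/lfunP => y; rewrite lfunE /=.
by have := z0 (y, 0); rewrite /natural_form /= lfunE add0r.
Qed.

Lemma nondegenerate_natural_form A :
  nondegenerate (@natural_form K A : {symmetric (A * dual A)%type}).
Proof.
rewrite /nondegenerate -subv0; apply/subvP => z /mem_orthovP z0.
rewrite memv0; apply/eqP/natural_form_eq0 => w; exact: z0 (memvf w).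
Qed.

End Quadratic.

(** * Invariant brackets on the double and their four-form *)

Section Double.
Context {K : fieldType} {A : vectType K}.
Variables (br : {bilinear A -> A -> A}).
Variables (dbr : {bilinear dual A -> dual A -> dual A}).
Variables (brd : {bilinear (A * dual A) -> (A * dual A) -> (A * dual A)}).
Hypothesis brdl : forall x y, brd (x, 0) (y, 0) = (br x y, 0).
Hypothesis brdr : forall u v, brd (0, u) (0, v) = (0, dbr u v).
Hypothesis brd_inv : forall p q r,
  natural_form (brd p q) r = natural_form p (alt brd r q).

Definition four_form p q r s : K :=
  natural_form (alt brd p q) (alt brd r s)
  + natural_form (alt brd q r) (alt brd p s)
  + natural_form (alt brd r p) (alt brd q s).

(** Invariance moves each outer bracket to the other argument of the form, as a commutator. *)
Lemma natural_form_jacobiator p q r s :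
  natural_form (jacobiator brd p q r) s = - four_form p q r s.
Proof.
have E x y z w : natural_form (brd (alt brd x y) z) w =
    - natural_form (alt brd x y) (alt brd z w).
  by rewrite brd_inv -[alt brd w z]opprB linearNr.
by rewrite /jacobiator 2!(linearDl (@natural_form K A)) /= !E /four_form !opprD.
Qed.

Lemma left_alia_double :
  left_alia brd <-> forall p q r s, four_form p q r s = 0.
Proof.
rewrite left_aliaP; split=> [jac0 p q r s | form0 p q r].
  by rewrite -[LHS]opprK -natural_form_jacobiator jac0 linear0l oppr0.
by apply: natural_form_eq0 => s; rewrite natural_form_jacobiator form0 oppr0.
Qed.

(* Locked because its unfolding, the component of a difference, would be split
   by additivity lemmas. *)
Definition mixed x v : A := locked (alt brd (x, 0) (0, v)).1.

(** Invariance on [(0, u)], [(0, v)], [(x, 0)] expresses the [A]-component of a mixed commutator by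
    [dbr]. *)
Lemma dual_mixed (u : dual A) v x : u (mixed x v) = dbr u v x.
Proof.
have := brd_inv (0, u) (0, v) (x, 0); rewrite /mixed -lock.
by rewrite brdr /natural_form /= !linear0 !add0r => ->.
Qed.

(** Invariance on [(y, 0)], [(x, 0)], [(0, v)] expresses the dual component by [br]. *)
Lemma alt_mixed x v : alt brd (x, 0) (0, v) = (mixed x v, - rmul_dual br x v).
Proof.
rewrite [LHS]surjective_pairing /mixed -lock; congr (_, _); apply/lfunP => y.
have := brd_inv (y, 0) (x, 0) (0, v).
rewrite brdl /natural_form /= !zero_lfunE !addr0 opp_lfunE rmul_dualE => ->.
by rewrite !add_lfunE !opp_lfunE opprB.
Qed.

Lemma alt_double x u y v : alt brd (x, u) (y, v) =
  (alt br x y + mixed x v - mixed y u,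
   alt dbr u v - rmul_dual br x v + rmul_dual br y u).
Proof.
have split_pair (p : A * dual A) : p = (p.1, 0) + (0, p.2).
  by case: p => a b; congr (_, _); rewrite /= ?addr0 ?add0r.
have -> : alt brd (x, u) (y, v) =
    alt brd (x, 0) (y, 0) + alt brd (x, 0) (0, v) - alt brd (y, 0) (0, u)
    + alt brd (0, u) (0, v).
  rewrite (split_pair (x, u)) (split_pair (y, v)) /alt !linearDl !linearDr /=.
  by apply: dual_inj => f; rewrite !(dualD, dualN); ring.
rewrite !alt_mixed {1 2}/alt !brdl !brdr.
congr (_, _); rewrite /= subr0 ?addr0 // sub0r opprK /alt.
by rewrite addrC addrA.
Qed.

(** One of the two summands of the natural form on two commutators; the other arises by exchanging
    them. The expansion leaves only bracket values as atoms for [ring]. *)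
Lemma alt_double_pairing x u y v z w t s :
  (alt brd (z, w) (t, s)).2 (alt brd (x, u) (y, v)).1 =
    dbr w s (br x y) - dbr w s (br y x) - dbr s w (br x y) + dbr s w (br y x)
    + dbr (dbr w s) v x - dbr (dbr s w) v x - dbr (dbr w s) u y
    + dbr (dbr s w) u y
    - s (br (br x y) z) + s (br (br y x) z)
    + w (br (br x y) t) - w (br (br y x) t)
    - dbr (rmul_dual br z s) v x + dbr (rmul_dual br z s) u y
    + dbr (rmul_dual br t w) v x - dbr (rmul_dual br t w) u y.
Proof.
rewrite !alt_double /alt [LHS]/= !(add_lfunE, opp_lfunE) !(dualD, dualN).
rewrite !dual_mixed !rmul_dualE; ring.
Qed.

(* The right-hand side runs over the ways to take each argument from [A] or
   [A^*]: six with two of each kind, four with three from [A], four with three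
   from [A^*]. *)
Lemma four_formE x u y v z w t s :
  four_form (x, u) (y, v) (z, w) (t, s) =
    bialgebra_defect br dbr x y w s + bialgebra_defect br dbr y z u s
    + bialgebra_defect br dbr z x v s + bialgebra_defect br dbr z t u v
    + bialgebra_defect br dbr x t v w + bialgebra_defect br dbr y t w u
    - s (jacobiator br x y z) + w (jacobiator br x y t)
    + u (jacobiator br y z t) + v (jacobiator br z x t)
    - jacobiator dbr u v w t + jacobiator dbr u v s z
    + jacobiator dbr v w s x + jacobiator dbr w u s y.
Proof.
rewrite /four_form /natural_form !alt_double_pairing.
rewrite /bialgebra_defect /jacobiator /alt.
rewrite !(linearBl br) /= !(linearBl dbr) /=.
by rewrite !(add_lfunE, opp_lfunE) !(dualD, dualN); ring.
Qed.

End Double.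

(** * The double is left-Alia exactly when the defect vanishes *)

Lemma rmul_dual0l {K : fieldType} {A : vectType K}
  (br : {bilinear A -> A -> A}) (u : dual A) : rmul_dual br 0 u = 0.
Proof. by apply/lfunP => y; rewrite rmul_dualE linear0r linear0 zero_lfunE. Qed.

Lemma bialgebra_defect0l {K : fieldType} {A : vectType K}
    (br : {bilinear A -> A -> A})
    (dbr : {bilinear dual A -> dual A -> dual A}) y u v :
  bialgebra_defect br dbr 0 y u v = 0.
Proof.
rewrite /bialgebra_defect !rmul_dual0l !linear0l linear0r subrr !linear0.
by rewrite !zero_lfunE !subr0 !addr0.
Qed.

Lemma bialgebra_defectN {K : fieldType} {A : vectType K}
    (br : {bilinear A -> A -> A})
    (dbr : {bilinear dual A -> dual A -> dual A}) x y u v :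
  bialgebra_defect br dbr y x u v = - bialgebra_defect br dbr x y u v.
Proof. by rewrite /bialgebra_defect !(dualD, dualN); ring. Qed.

Lemma left_alia_doubleP {K : fieldType} {A : vectType K}
    (br : {bilinear A -> A -> A})
    (dbr : {bilinear dual A -> dual A -> dual A})
    (brd : {bilinear (A * dual A) -> (A * dual A) -> (A * dual A)}) :
  left_alia br -> left_alia dbr ->
  (forall x y, brd (x, 0) (y, 0) = (br x y, 0)) ->
  (forall u v, brd (0, u) (0, v) = (0, dbr u v)) ->
  (forall p q r, natural_form (brd p q) r = natural_form p (alt brd r q)) ->
  left_alia brd <-> forall x y u v, bialgebra_defect br dbr x y u v = 0.
Proof.
move=> /left_aliaP br_jac /left_aliaP dbr_jac brdl brdr brd_inv.
rewrite (left_alia_double brd_inv).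
have formE x u y v z w t s : four_form brd (x, u) (y, v) (z, w) (t, s) =
    bialgebra_defect br dbr x y w s + bialgebra_defect br dbr y z u s
    + bialgebra_defect br dbr z x v s + bialgebra_defect br dbr z t u v
    + bialgebra_defect br dbr x t v w + bialgebra_defect br dbr y t w u.
  rewrite (four_formE brdl brdr brd_inv) !br_jac !dbr_jac !linear0 !zero_lfunE.
  by rewrite !(addr0, subr0).
split=> [form0 x y u v | defect0 [x u] [y v] [z w] [t s]]; last first.
  by rewrite formE !defect0 !addr0.
have defect0r x' u' v' : bialgebra_defect br dbr x' 0 u' v' = 0.
  by rewrite bialgebra_defectN bialgebra_defect0l oppr0.
(* With two arguments from [A] and two from [dual A], five of the six defects have a zero
   argument. *)
have := formE x 0 y 0 0 u 0 v.
by rewrite form0 !bialgebra_defect0l !defect0r !addr0 => <-.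
Qed.

(** * Bilinear actions as linear maps into operators *)

Section CurryBilinear.
Context {K : fieldType} {U V W : vectType K}.
Variable f : {bilinear U -> V -> W}.

Definition curry_lfun (x : U) : 'Hom(V, W) := linfun (f x).

Lemma curry_lfun_is_linear : linear curry_lfun.
Proof.
move=> k x y; apply/lfunP => v.
by rewrite add_lfunE scale_lfunE !lfunE /= linearPl.
Qed.

HB.instance Definition _ :=
  GRing.isLinear.Build K U 'Hom(V, W) *:%R curry_lfun curry_lfun_is_linear.

End CurryBilinear.

(** * The coadjoint action of [A] on [dual A] *)

Section Coadjoint.
Context {K : fieldType} {A : vectType K}.
Variable br : {bilinear A -> A -> A}.

(* [coadl] and [coadr] are the only [l] and [r] for which the natural form is
   invariant: [l x = - (left multiplication)^*], [r x = (right - left)^*]. *)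
Definition coadl (x : A) (v : dual A) : dual A := (v \o - linfun (br x))%VF.
Definition coadr (x : A) (v : dual A) : dual A :=
  (v \o (linfun (rmul br x) - linfun (br x)))%VF.

Lemma coadlE x v y : coadl x v y = - (v (br x y) : K).
Proof. by rewrite comp_lfunE opp_lfunE lfunE dualN. Qed.

Lemma coadrE x v y : coadr x v y = (v (br y x) : K) - v (br x y).
Proof. by rewrite comp_lfunE add_lfunE opp_lfunE !lfunE dualD dualN. Qed.

Lemma coadl_is_bilinear : bilinear_for *:%R *:%R coadl.
Proof.
split=> [v k x y | x k u v]; apply/lfunP => z /=;
  rewrite [RHS]add_lfunE [in RHS]scale_lfunE !coadlE.
  by rewrite linearPl linearP /= scalerN opprD.
by rewrite add_lfunE scale_lfunE scalerN opprD.
Qed.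

Lemma coadr_is_bilinear : bilinear_for *:%R *:%R coadr.
Proof.
split=> [v k x y | x k u v]; apply/lfunP => z /=;
  rewrite [RHS]add_lfunE [in RHS]scale_lfunE !coadrE.
  by rewrite linearPl linearPr !(dualD, dualZ) -[k *: _]/(k * _); ring.
by rewrite !(add_lfunE, scale_lfunE) -![k *: _]/(k * _); ring.
Qed.

HB.instance Definition _ := bilinear_isBilinear.Build K A (dual A) (dual A)
  *:%R *:%R coadl coadl_is_bilinear.
HB.instance Definition _ := bilinear_isBilinear.Build K A (dual A) (dual A)
  *:%R *:%R coadr coadr_is_bilinear.

(** At [z], the two sides differ by [v] applied to [jacobiator br x y z], up to sign. *)
Lemma coad_representation : left_alia br ->
  representation br (curry_lfun coadl) (curry_lfun coadr).
Proof.
move=> /left_aliaP br_jac x y v; rewrite !lfunE /=; apply/lfunP => z.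
have := congr1 (v : A -> K) (br_jac x y z); rewrite /jacobiator /alt.
rewrite linear0 !linearBl /= !(dualD, dualN) => jac.
rewrite !(add_lfunE, opp_lfunE) !(coadlE, coadrE).
rewrite -[LHS]addr0 -jac; ring.
Qed.

End Coadjoint.

(** * The coadjoint action of [dual A] on [A], and the double bracket *)

Section DualCoadjoint.
Context {K : fieldType} {A : vectType K}.
Variable br : {bilinear A -> A -> A}.
Variable dbr : {bilinear dual A -> dual A -> dual A}.
Variable delta : {linear A -> tensor A A}.

(** The coadjoint maps of [dbr], written by contracting [delta] so that they act on [A] itself and
    not on its bidual. *)
Definition dual_coadl (u : dual A) (y : A) : A :=
  contract (- u) (tau (delta y)).
Definition dual_coadr (u : dual A) (y : A) : A :=
  contract u (delta y - tau (delta y)).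

Lemma dual_coadl_is_bilinear : bilinear_for *:%R *:%R dual_coadl.
Proof.
split=> [x k u v | u k x y]; last by rewrite /dual_coadl !linearP.
rewrite /dual_coadl opprD -scalerN; exact: contract_is_linear_dual.
Qed.

Lemma dual_coadr_is_bilinear : bilinear_for *:%R *:%R dual_coadr.
Proof.
split=> [x k u v | u k x y]; first exact: contract_is_linear_dual.
rewrite /dual_coadr (linearP delta) (linearP tau) opprD addrACA -scalerBr.
exact: linearP.
Qed.

HB.instance Definition _ := bilinear_isBilinear.Build K (dual A) A A
  *:%R *:%R dual_coadl dual_coadl_is_bilinear.
HB.instance Definition _ := bilinear_isBilinear.Build K (dual A) A A
  *:%R *:%R dual_coadr dual_coadr_is_bilinear.

Definition double_bracket (p q : A * dual A) : A * dual A :=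
  (br p.1 q.1 + (dual_coadl p.2 q.1 + dual_coadr q.2 p.1),
   coadl br p.1 q.2 + coadr br q.1 p.2 + dbr p.2 q.2).

Lemma double_bracket_is_bilinear : bilinear_for *:%R *:%R double_bracket.
Proof.
split=> [r k p q | r k p q]; rewrite /double_bracket /=.
  rewrite !linearPl !linearPr; congr (_, _); rewrite /= !scalerDr.
    by apply: dual_inj => w; rewrite !(dualD, dualZ); ring.
  by apply: dual_inj => w; rewrite !(dualD, dualZ); ring.
rewrite !linearPl !linearPr; congr (_, _); rewrite /= !scalerDr.
  by apply: dual_inj => w; rewrite !(dualD, dualZ); ring.
by apply: dual_inj => w; rewrite !(dualD, dualZ); ring.
Qed.

HB.instance Definition _ := bilinear_isBilinear.Build K
  (A * dual A)%type (A * dual A)%type (A * dual A)%type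
  *:%R *:%R double_bracket double_bracket_is_bilinear.

Lemma double_bracketl x y : double_bracket (x, 0) (y, 0) = (br x y, 0).
Proof. by rewrite /double_bracket /= !(linear0l, linear0r) !addr0. Qed.

Lemma double_bracketr u v : double_bracket (0, u) (0, v) = (0, dbr u v).
Proof. by rewrite /double_bracket /= !(linear0l, linear0r) !(add0r, addr0). Qed.

Hypothesis delta_dual : forall (a b : dual A) (x : A),
  dbr a b x = tensor_pairing a b (delta x).

Lemma dual_coadlE (w u : dual A) y : w (dual_coadl u y) = - (dbr u w y : K).
Proof.
rewrite dual_contract tensor_pairing_tau -delta_dual linearNl.
exact: opp_lfunE.
Qed.

Lemma dual_coadrE (w u : dual A) y :
  w (dual_coadr u y) = (dbr w u y : K) - dbr u w y.
Proof.
by rewrite dual_contract linearB /= tensor_pairing_tau -!delta_dual.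
Qed.

(** Under a functional [w], the two sides differ by [jacobiator dbr u v w] at [x], up to sign. *)
Lemma dual_coad_representation : left_alia dbr ->
  representation dbr (curry_lfun dual_coadl) (curry_lfun dual_coadr).
Proof.
move=> /left_aliaP dbr_jac u v x; rewrite !lfunE /=; apply: dual_inj => w.
have := congr1 (fun f : dual A => f x : K) (dbr_jac u v w).
rewrite /jacobiator /alt zero_lfunE !linearBl /= !(add_lfunE, opp_lfunE) => jac.
rewrite !(dualD, dualN) !(dual_coadlE, dual_coadrE).
by rewrite -[LHS]addr0 -jac; ring.
Qed.

(** Both coadjoint actions are adjoints for the pairing, so expanding into values of [br] and [dbr]
    makes the two sides agree. *)
Lemma double_bracket_inv p q r :
  natural_form (double_bracket p q) r =
  natural_form p (alt double_bracket r q).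
Proof.
case: p q r => [x u] [y v] [z w]; rewrite /natural_form /alt /double_bracket /=.
rewrite !(add_lfunE, opp_lfunE) !(coadlE, coadrE) !(dualD, dualN).
by rewrite !(dual_coadlE, dual_coadrE); ring.
Qed.

End DualCoadjoint.

Theorem theoremB (K : closedFieldType) (charK0 : [pchar K] =i pred0)
    (A : vectType K)
    (br : {bilinear A -> A -> A}) (br_alia : left_alia br)
    (dbr : {bilinear dual A -> dual A -> dual A}) (dbr_alia : left_alia dbr)
    (delta : {linear A -> tensor A A})
    (delta_dual : forall (a b : dual A) (x : A),
       dbr a b x = tensor_pairing a b (delta x)) :
  (exists (l r : {linear A -> 'End(dual A)})
          (l' r' : {linear dual A -> 'End(A)})
          (brd : {bilinear (A * dual A) -> (A * dual A) -> (A * dual A)}),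
     [/\ representation br l r,
         representation dbr l' r',
         forall (x y : A) (u v : dual A),
           brd (x, u) (y, v) =
             (br x y, l x v + r y u) + (l' u y + r' v x, dbr u v)
       & manin_triple br dbr brd])
  <-> left_alia_bialgebra br delta.
Proof.
have [to_defect of_defect] := bialgebra_defectP br delta_dual.
split=> [[l [r [l' [r' [brd [_ _ _ [brdl brdr [brd_alia _ brd_inv]]]]]]]] |
         [_ _ /to_defect defect0]].
  split=> //; first exact: left_alia_coalgebra_dual dbr_alia.
  (* Any Manin triple bracket is invariant and extends [br] and [dbr], so its left-Alia identity
     forces the defect to vanish. *)
  by apply/of_defect/(left_alia_doubleP br_alia dbr_alia brdl brdr brd_inv).
(* Conversely, the witness is the bracket built from the two coadjoint actions. *)
pose brd : {bilinear (A * dual A) -> (A * dual A) -> (A * dual A)} :=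
  double_bracket br dbr delta.
exists (curry_lfun (coadl br)), (curry_lfun (coadr br)),
  (curry_lfun (dual_coadl delta)), (curry_lfun (dual_coadr delta)), brd.
have brdl : forall x y, brd (x, 0) (y, 0) = (br x y, 0).
  exact: double_bracketl.
have brdr : forall u v, brd (0, u) (0, v) = (0, dbr u v).
  exact: double_bracketr.
have brd_inv : forall p q r,
    natural_form (brd p q) r = natural_form p (alt brd r q).
  exact: double_bracket_inv.
split.
- exact: coad_representation.
- exact: dual_coad_representation.
- by move=> x y u v; rewrite !lfunE.
split=> //; split=> //; last exact: nondegenerate_natural_form.
by apply/(left_alia_doubleP br_alia dbr_alia brdl brdr brd_inv).
Qed.
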